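(* Let $\mathcal{H}$ be a Hilbert space, $T$ a bounded linear operator on $\mathcal{H}$, $J$ a countable (finite or countably infinite) index set, and $f_j\in\mathcal{H}$ for $j\in J$. Then the family $\{T^n f_j : n\in\mathbb{N}_0,\ j\in J\}$ is a frame for $\mathcal{H}$ if and only if there exist an $S$-coinvariant closed subspace $K\subset H^2(\mathbb{T},\ell^2(J))$ and an invertible operator $V:K\to\mathcal{H}$ such that $$V^{-1}TV=S_K\quad\text{and}\quad V(P_Ke_j)=f_j\ \text{ for all } j\in J,$$ where $\{e_j\}_{j\in J}$ is the standard basis of $\ell^2(J)$.
   Context: $\mathbb{N}_0$ is the set of nonnegative integers and $\mathbb{T}$ the unit circle. A countable indexed family $\{x_i\}_{i\in I}$ in a Hilbert space $\mathcal{H}$ is a frame for $\mathcal{H}$ if there are constants $A,B>0$ with $A\|h\|^2\le\sum_{i}|\langle h,x_i\rangle|^2\le B\|h\|^2$ for all $h\in\mathcal{H}$. $H^2(\mathbb{T},\ell^2(J))$ is the Hardy space of functions $g(z)=\sum_{n\ge0}a_nz^n$ with $a_n\in\ell^2(J)$ and $\|g\|^2=\sum_{n\ge0}\|a_n\|^2_{\ell^2(J)}<\infty$; $\ell^2(J)$ is identified with the closed subspace of constant functions. $S$ is the operator of multiplication by $z$ on $H^2(\mathbb{T},\ell^2(J))$. For a closed subspace $K$, $P_K$ is the orthogonal projection onto $K$ and $S_K:=P_KS|_K:K\to K$ is the compression of $S$ to $K$. $K$ is $S$-coinvariant if $K^\perp$ is $S$-invariant. An invertible operator is a bounded linear bijection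 with bounded inverse. *)

(* Defs.v *)
From HB Require Import structures.
From mathcomp Require Import all_boot all_order all_algebra.
From mathcomp Require Import complex finmap ring lra.
From mathcomp Require Import all_classical all_reals all_analysis.
Set Implicit Arguments.
Unset Strict Implicit.
Unset Printing Implicit Defensive.
Import Order.TTheory GRing.Theory Num.Theory.
Import numFieldNormedType.Exports.
Local Open Scope classical_set_scope.
Local Open Scope ring_scope.
Local Open Scope complex_scope.

(* Complex Hilbert spaces; hdot is linear in its first argument. *)
HB.mixin Record CompleteNormedModule_isHilbert (R : realType) H
    of CompleteNormedModule R[i] H := {
  hdot : {dot H for Num.conj} ;
  hdotxx : forall x : H, hdot x x = `|x| ^+ 2
}.

#[short(type="hilbertType")]
HB.structure Definition Hilbert (R : realType) :=
  {H of CompleteNormedModule R[i] H & CompleteNormedModule_isHilbert R H}.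

(* Norms over R[i] take their values in R[i]; rnorm is the same number in R
   (see rnormE). *)
Definition rnorm (R : realType) (V : normedModType R[i]) (x : V) : R :=
  complex.Re `|x|.

Section RealNorm.
Variables (R : realType) (V : normedModType R[i]).
Implicit Types x y : V.

Lemma rnormE x : (rnorm x)%:C = `|x|.
Proof. by rewrite /rnorm RRe_real// ger0_real. Qed.

Lemma rnorm_ge0 x : 0 <= rnorm x.
Proof. by rewrite -ler0c rnormE. Qed.

Lemma rnormD x y : rnorm (x + y) <= rnorm x + rnorm y.
Proof. by rewrite -lecR rmorphD/= !rnormE ler_normD. Qed.

Lemma rnormZ (a : R[i]) x : rnorm (a *: x) = rnorm (a : R[i]^o) * rnorm x.
Proof. by apply: complexI; rewrite rmorphM/= !rnormE normrZ. Qed.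

Lemma rnorm0_eq0 x : rnorm x = 0 -> x = 0.
Proof. by move=> x0; apply/normr0_eq0; rewrite -rnormE x0. Qed.

Lemma rnorm0 : rnorm (0 : V) = 0.
Proof. by rewrite /rnorm normr0. Qed.

Lemma rnormN x : rnorm (- x) = rnorm x.
Proof. by rewrite /rnorm normrN. Qed.

Lemma rnorm_distC x y : rnorm (x - y) = rnorm (y - x).
Proof. by rewrite /rnorm distrC. Qed.

End RealNorm.

Section DotTriangle.
Variables (C : numClosedFieldType) (U : lmodType C) (f : {dot U for Num.conj}).

Lemma dot_CauchySchwarz u v : `|f u v| ^+ 2 <= f u u * f v v.
Proof.
have [->|v0] := eqVneq v 0.
  by rewrite !(linear0r f) normr0 expr0n mulr_ge0// dnorm_ge0.
pose a := f u v / f v v; pose w := u - a *: v.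
have wv : f w v = 0.
  by rewrite linearBl/= linearZl_LR divfK ?dnorm_eq0 ?subrr.
have -> : u = w + a *: v by rewrite /w subrK.
rewrite linearDl/= wv add0r linearZl_LR/= hnormDd/=; last first.
  by rewrite linearZr_LR/= wv mulr0.
rewrite dnormZ normrM exprMn (ger0_norm (dnorm_ge0 f v)) mulrDl.
by rewrite (expr2 (f v v)) mulrA lerDr mulr_ge0// dnorm_ge0.
Qed.

Lemma dot_triangle u v :
  sqrtC (f (u + v) (u + v)) <= sqrtC (f u u) + sqrtC (f v v).
Proof.
have su : 0 <= sqrtC (f u u) + sqrtC (f v v) by rewrite addr_ge0 ?sqrt_dnorm_ge0.
rewrite -(@ler_pXn2r _ 2)// ?nnegrE ?sqrt_dnorm_ge0// sqrtCK dnormD sqrrD !sqrtCK.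
rewrite addrAC lerD2r lerD2l.
have cs : `|f u v| <= sqrtC (f u u) * sqrtC (f v v).
  rewrite -(@ler_pXn2r _ 2)// ?nnegrE ?mulr_ge0 ?sqrt_dnorm_ge0//.
  by rewrite exprMn !sqrtCK dot_CauchySchwarz.
have -> : f u v + (f u v)^*%R = 'Re (f u v) *+ 2.
  by rewrite ReE -[in RHS]mulr_natr divfK ?pnatr_eq0.
rewrite lerMn2r/=; apply: le_trans cs; exact: leif_Re_Creal.
Qed.
End DotTriangle.

Section ComplexComplete.
Variable R : realType.
Notation C := (R[i]^o).

Lemma Re_le (x : R[i]) : `|complex.Re x| <= complex.Re `|x|.
Proof. by rewrite -lecR (le_trans (normc_ge_Re x))// RRe_real// ger0_real. Qed.

Lemma Im_le (x : R[i]) : `|complex.Im x| <= complex.Re `|x|.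
Proof.
case: x => a b /=; rewrite -sqrtr_sqr ler_wsqrtr// lerDr sqr_ge0//.
Qed.

Lemma normc_le (x : R[i]) : complex.Re `|x| <= `|complex.Re x| + `|complex.Im x|.
Proof.
case: x => a b /=; rewrite -(@ler_pXn2r _ 2)// ?nnegrE ?addr_ge0// ?sqrtr_ge0//.
rewrite sqr_sqrtr ?addr_ge0 ?sqr_ge0// sqrrD !real_normK ?num_real//.
by rewrite addrAC lerDl mulrn_wge0// mulr_ge0.
Qed.

Lemma complex_complete (F : set_system C) :
  ProperFilter F -> cauchy F -> cvg F.
Proof.
move=> FF /cauchyP Fc.
have part (p : C -> R) : (forall x y, `|p x - p y| <= complex.Re `|x - y|) ->
    cvg (p @ F).
  move=> pL; apply: (@cauchy_cvg R); apply: cauchy_exP => e e0.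
  have [|x Fx] := Fc e%:C; first by rewrite ltcR.
  exists (p x); suff : F (p @^-1` ball (p x) e) by [].
  apply: filterS Fx => y; rewrite -!ball_normE/= => xy.
  by apply: le_lt_trans (pL _ _) _; rewrite -ltcR RRe_real// ger0_real.
have /cvg_ex[/= a Fa] : cvg ((@complex.Re R : C -> R) @ F).
  by apply: part => x y; rewrite -raddfB; exact: Re_le.
have /cvg_ex[/= b Fb] : cvg ((@complex.Im R : C -> R) @ F).
  by apply: part => x y; rewrite -raddfB; exact: Im_le.
apply/cvg_ex; exists (a +i* b : C); apply/cvgrPdist_lt => /= e e0.
have {e0}[r r0 ->] : exists2 r : R, 0 < r & e = r%:C.
  by exists (complex.Re e); rewrite ?RRe_real ?gtr0_real// -ltcR RRe_real ?gtr0_real.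
have r2 : 0 < r / 2 by rewrite divr_gt0.
move/cvgrPdist_lt : Fa => /(_ _ r2) Fa; move/cvgrPdist_lt : Fb => /(_ _ r2) Fb.
have Fab : \forall x \near F,
    `|a - complex.Re x| < r / 2 /\ `|b - complex.Im x| < r / 2.
  by near=> x; split; near: x.
apply: filterS Fab => -[x1 x2] /= [ax bx].
rewrite -[X in X < _]RRe_real ?ger0_real// ltcR.
by apply: (le_lt_trans (normc_le _)); rewrite (splitr r) ltrD.
Unshelve. all: by end_near. Qed.
End ComplexComplete.

(* The scalars R[i] as a Hilbert space. An alias is used because the completeType
   instance keyed on R[i]^o is reserved by the library to R : realType. *)
Definition Cspace (R : realType) : Type := R[i].

Section ComplexHilbert.
Variable R : realType.

HB.instance Definition _ := NormedModule.copy (Cspace R) (R[i]^o).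

HB.instance Definition _ :=
  Uniform_isComplete.Build (Cspace R) (@complex_complete R).

Definition cdot (x y : (Cspace R)) : R[i] := (x : R[i]) * Num.conj (y : R[i]).

Lemma cdot_bilinear :
  bilinear_for (GRing.mul : GRing.Scale.law R[i] R[i])
    (Num.conj \; GRing.mul : GRing.Scale.law R[i] R[i]) cdot.
Proof.
split=> [y a x x'|x a y y']; rewrite /cdot/=.
  by rewrite mulrDl -scalerAl.
by rewrite rmorphD rmorphM/= mulrDr mulrCA.
Qed.

HB.instance Definition _ :=
  @bilinear_isBilinear.Build R[i] (Cspace R) (Cspace R) R[i] *%R (Num.conj \; *%R) cdot
    cdot_bilinear.

Lemma cdotC (x y : (Cspace R)) : cdot x y = (-1) ^+ false * Num.conj (cdot y x).
Proof. by rewrite /cdot rmorphM/= conjCK mul1r mulrC. Qed.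

HB.instance Definition _ := @isHermitianSesquilinear.Build R[i] (Cspace R) false
  Num.conj cdot cdotC.

Lemma cdot_gt0 (x : (Cspace R)) : x != 0 -> 0 < cdot x x.
Proof. by move=> x0; rewrite /cdot -normCK exprn_gt0// normr_gt0. Qed.

HB.instance Definition _ := @isDotProduct.Build R[i] (Cspace R) cdot cdot_gt0.

Lemma cdotxx (x : (Cspace R)) : cdot x x = `|x| ^+ 2.
Proof. by rewrite /cdot -normCK. Qed.

HB.instance Definition _ :=
  CompleteNormedModule_isHilbert.Build R (Cspace R) cdotxx.
End ComplexHilbert.

Section RealSum.
Variables (R : realType) (I : choiceType).
Implicit Types (u v : I -> R) (c : R).
Notation esumT u := (\esum_(i in [set: I]) (u i)%:E)%E.

(* Sum of an absolutely summable family (u i)_i, as the difference of the sums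
   of its positive and negative parts. *)
Definition rsum u : R :=
  fine (esum [set: I] (EFin \o u)^\+ - esum [set: I] (EFin \o u)^\-)%E.

Lemma esumT_ge0 u : (forall i, 0 <= u i) -> (0 <= esumT u)%E.
Proof. by move=> u0; apply: esum_ge0 => i _; rewrite lee_fin. Qed.

Lemma esumT_fin u : (forall i, 0 <= u i) -> (esumT u < +oo)%E ->
  esumT u \is a fin_num.
Proof. by move=> u0 ufin; rewrite ge0_fin_numE ?esumT_ge0. Qed.

Lemma esumT_le u v : (forall i, u i <= v i) -> (esumT u <= esumT v)%E.
Proof. by move=> uv; apply: le_esum => i _; rewrite lee_fin. Qed.

Lemma esumTD u v : (forall i, 0 <= u i) -> (forall i, 0 <= v i) ->
  esumT (fun i => u i + v i) = (esumT u + esumT v)%E.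
Proof.
by move=> u0 v0; rewrite -esumD// => i _; rewrite lee_fin.
Qed.

Lemma esumTZ c u : 0 <= c -> (forall i, 0 <= u i) ->
  esumT (fun i => c * u i) = (c%:E * esumT u)%E.
Proof.
move=> c0 u0; rewrite /esum -ereal_supZl//; last first.
  by apply/set0P; exists (\sum_(i \in set0) (u i)%:E)%E; exists set0.
rewrite image_comp; congr ereal_sup; apply: eq_imagel => X /= [finX _].
by rewrite ge0_mule_fsumr.
Qed.

Lemma esumT_fsetP u (M : R) : (forall i, 0 <= u i) ->
  (forall X : {fset I}, \sum_(i <- X) u i <= M) <-> (esumT u <= M%:E)%E.
Proof.
move=> u0; split=> [uM|uM X].
  rewrite /esum ge_ereal_sup// => _ [X [finX _]] <-.
  by rewrite fsbig_finite//= sumEFin lee_fin.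
rewrite -lee_fin -sumEFin (le_trans _ uM)//; apply: esum_ge.
by exists [set` X]; [split|rewrite fsbig_finite//= set_fsetK].
Qed.

Lemma rsumB u v : (forall i, 0 <= u i) -> (forall i, 0 <= v i) ->
  (esumT u < +oo)%E -> (esumT v < +oo)%E ->
  rsum (fun i => u i - v i) = fine (esumT u) - fine (esumT v).
Proof.
move=> u0 v0 ufin vfin; rewrite -fineB ?esumT_fin// /rsum.
have sm (w : I -> R) : (forall i, 0 <= w i) -> (esumT w < +oo)%E ->
    summable [set: I] (EFin \o w).
  move=> w0 wf; rewrite /summable; apply: le_lt_trans wf.
  by apply: le_esum => i _ /=; rewrite ger0_norm.
by rewrite -(esumB (sm _ u0 ufin) (sm _ v0 vfin))// => i _ /=; rewrite lee_fin.
Qed.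

Lemma rsum_ge0E u : (forall i, 0 <= u i) -> (esumT u < +oo)%E ->
  rsum u = fine (esumT u).
Proof.
move=> u0 ufin; have z0 : esumT (fun=> 0 : R) = 0%E by rewrite esum1.
have := @rsumB u (fun=> 0) u0 (fun=> lexx 0) ufin.
rewrite z0 subr0 => <- //; congr rsum; apply/funext => i; by rewrite subr0.
Qed.

Definition posp u : I -> R := fun i => Num.max (u i) 0.
Definition negp u : I -> R := fun i => Num.max (- u i) 0.

Lemma posp_ge0 u i : 0 <= posp u i. Proof. by rewrite le_max lexx orbT. Qed.
Lemma negp_ge0 u i : 0 <= negp u i. Proof. by rewrite le_max lexx orbT. Qed.

Lemma posnegE u i : u i = posp u i - negp u i.
Proof.
rewrite /posp /negp; have [u0|u0] := leP 0 (u i).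
  by rewrite max_r ?oppr_le0// subr0.
by rewrite max_l ?oppr_ge0 1?ltW// sub0r opprK.
Qed.

Lemma posp_fin u : (esumT (fun i => `|u i|) < +oo -> esumT (posp u) < +oo)%E.
Proof.
apply: le_lt_trans; apply: esumT_le => i.
by rewrite /posp ge_max normr_ge0 ler_norm.
Qed.

Lemma negp_fin u : (esumT (fun i => `|u i|) < +oo -> esumT (negp u) < +oo)%E.
Proof.
apply: le_lt_trans; apply: esumT_le => i.
by rewrite /negp ge_max normr_ge0 -normrN ler_norm.
Qed.

Lemma rsumE u : (esumT (fun i => `|u i|) < +oo)%E ->
  rsum u = fine (esumT (posp u)) - fine (esumT (negp u)).
Proof.
move=> ufin; rewrite -rsumB//; try exact: posp_ge0; try exact: negp_ge0.
- by congr rsum; apply/funext => i; exact: posnegE.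
- exact: posp_fin.
- exact: negp_fin.
Qed.

Lemma rsumD u v : (esumT (fun i => `|u i|) < +oo)%E ->
  (esumT (fun i => `|v i|) < +oo)%E ->
  rsum (fun i => u i + v i) = rsum u + rsum v.
Proof.
move=> uf vf; have [pu pv] := (@posp_ge0 u, @posp_ge0 v).
have [nu nv] := (@negp_ge0 u, @negp_ge0 v).
have [fpu fpv] := (posp_fin uf, posp_fin vf).
have [fnu fnv] := (negp_fin uf, negp_fin vf).
rewrite (rsumE uf) (rsumE vf) addrACA -opprD -!fineD ?esumT_fin//.
rewrite -!esumTD// -rsumB.
- by congr rsum; apply/funext => i; rewrite {1}posnegE {1}(posnegE v) addrACA opprD.
- by move=> i; rewrite addr_ge0.
- by move=> i; rewrite addr_ge0.
- by rewrite esumTD// lte_add_pinfty.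
- by rewrite esumTD// lte_add_pinfty.
Qed.

Lemma rsumN u : (esumT (fun i => `|u i|) < +oo)%E ->
  rsum (fun i => - u i) = - rsum u.
Proof.
move=> uf; rewrite (rsumE uf) opprB -rsumB.
- by congr rsum; apply/funext => i; rewrite {1}posnegE opprB.
- exact: negp_ge0.
- exact: posp_ge0.
- exact: negp_fin.
- exact: posp_fin.
Qed.

Lemma rsumZ c u : (esumT (fun i => `|u i|) < +oo)%E ->
  rsum (fun i => c * u i) = c * rsum u.
Proof.
move=> uf.
have pos d : 0 <= d -> rsum (fun i => d * u i) = d * rsum u.
  move=> d0; rewrite (rsumE uf) mulrBr.
  have pE : d * fine (esumT (posp u)) = fine (esumT (fun i => d * posp u i)).
    by rewrite esumTZ ?fineM ?esumT_fin ?posp_fin//; exact: posp_ge0.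
  have nE : d * fine (esumT (negp u)) = fine (esumT (fun i => d * negp u i)).
    by rewrite esumTZ ?fineM ?esumT_fin ?negp_fin//; exact: negp_ge0.
  rewrite pE nE -rsumB.
  - by congr rsum; apply/funext => i; rewrite {1}posnegE mulrBr.
  - by move=> i; rewrite mulr_ge0 ?posp_ge0.
  - by move=> i; rewrite mulr_ge0 ?negp_ge0.
  - rewrite esumTZ//; last exact: posp_ge0.
    by rewrite lte_mul_pinfty ?posp_fin// lee_fin.
  - rewrite esumTZ//; last exact: negp_ge0.
    by rewrite lte_mul_pinfty ?negp_fin// lee_fin.
have [c0|c0] := leP 0 c; first exact: pos.
rewrite -[c]opprK mulNr -pos ?oppr_ge0 1?ltW// -rsumN.
  by congr rsum; apply/funext => i; rewrite opprK mulNr opprK.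
apply: (@le_lt_trans _ _ (esumT (fun i => `|- c| * `|u i|))).
  by apply: esumT_le => i; rewrite normrM.
by rewrite esumTZ// lte_mul_pinfty// lee_fin.
Qed.

End RealSum.

Section ComplexSum.
Variables (R : realType) (I : choiceType).
Implicit Types (u v : I -> R[i]).

Definition csum u : R[i] :=
  rsum (fun i => complex.Re (u i)) +i* rsum (fun i => complex.Im (u i)).

Definition csummable u : Prop :=
  (\esum_(i in [set: I]) (complex.Re `|u i|)%:E < +oo)%E.

Lemma csummable_Re u : csummable u ->
  (\esum_(i in [set: I]) `|complex.Re (u i)|%:E < +oo)%E.
Proof. by apply: le_lt_trans; apply: esumT_le => i; exact: Re_le. Qed.

Lemma csummable_Im u : csummable u ->
  (\esum_(i in [set: I]) `|complex.Im (u i)|%:E < +oo)%E.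
Proof. by apply: le_lt_trans; apply: esumT_le => i; exact: Im_le. Qed.

Lemma csumD u v : csummable u -> csummable v ->
  csum (fun i => u i + v i) = csum u + csum v.
Proof.
move=> us vs; have [ru rv] := (csummable_Re us, csummable_Re vs).
have [iu iv] := (csummable_Im us, csummable_Im vs).
apply/eqP; rewrite eq_complex /=; apply/andP; split; apply/eqP.
  rewrite -[RHS](rsumD ru rv); congr rsum; apply/funext => i.
  by rewrite raddfD.
rewrite -[RHS](rsumD iu iv); congr rsum; apply/funext => i.
by rewrite raddfD.
Qed.

Lemma csumZ (c : R[i]) u : csummable u ->
  csum (fun i => c * u i) = c * csum u.
Proof.
move=> us; have [ru iu] := (csummable_Re us, csummable_Im us).
have absZ d (w : I -> R) : (\esum_(i in [set: I]) `|w i|%:E < +oo)%E ->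
    (\esum_(i in [set: I]) `|d * w i|%:E < +oo)%E.
  move=> wf; apply: (@le_lt_trans _ _
    (\esum_(i in [set: I]) (`|d| * `|w i|)%:E)%E).
    by apply: esumT_le => i; rewrite normrM.
  by rewrite esumTZ// lte_mul_pinfty// lee_fin.
have absN (w : I -> R) : (\esum_(i in [set: I]) `|w i|%:E < +oo)%E ->
    (\esum_(i in [set: I]) `|- w i|%:E < +oo)%E.
  by apply: le_lt_trans; apply: esumT_le => i; rewrite normrN.
case: c => a b; apply/eqP; rewrite eq_complex /=; apply/andP; split; apply/eqP.
  rewrite -(rsumZ a ru) -(rsumZ b iu).
  rewrite -(rsumN (absZ _ _ iu)) -(rsumD (absZ _ _ ru) (absN _ (absZ _ _ iu))).
  by congr rsum; apply/funext => i; case: (u i).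
rewrite -(rsumZ a iu) -(rsumZ b ru) -(rsumD (absZ _ _ iu) (absZ _ _ ru)).
by congr rsum; apply/funext => i; case: (u i).
Qed.

Lemma csum_conj u : csummable u ->
  csum (fun i => Num.conj (u i)) = Num.conj (csum u).
Proof.
move=> us; have conjE (z : R[i]) : Num.conj z = z^*%C by [].
rewrite conjE /csum /=; congr (_ +i* _).
  by congr rsum; apply/funext => i; rewrite conjE; case: (u i).
rewrite -(rsumN (csummable_Im us)); congr rsum; apply/funext => i.
by rewrite conjE; case: (u i).
Qed.

Lemma csum_real (w : I -> R) : csum (fun i => (w i)%:C) = (rsum w)%:C.
Proof.
rewrite /csum/=; congr (_ +i* _).
by rewrite rsum_ge0E ?esum1 ?ltry.
Qed.

End ComplexSum.

Section Ell2.
Variables (R : realType) (I : choiceType) (E : hilbertType R).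

Definition ell2_pred : {pred (I -> E)} :=
  fun a => `[< \esum_(i in [set: I]) (rnorm (a i) ^+ 2)%:E < +oo >]%E.

Lemma ell2_submod_closed : submod_closed ell2_pred.
Proof.
split=> [|c a b].
  rewrite unfold_in; apply/asboolP; rewrite esum1// => i _.
  by rewrite rnorm0 expr0n.
rewrite !unfold_in => /asboolP af /asboolP bf; apply/asboolP.
pose k := 2 * rnorm (c : Cspace R) ^+ 2.
have k0 : 0 <= k by rewrite mulr_ge0// sqr_ge0.
apply: (@le_lt_trans _ _ (\esum_(i in [set: I])
    (k * rnorm (a i) ^+ 2 + 2 * rnorm (b i) ^+ 2)%:E)%E).
  apply: esumT_le => i /=.
  have := rnormD (c *: a i) (b i); rewrite rnormZ => h.
  have := rnorm_ge0 (c *: a i + b i); set z := rnorm (c *: _ + _) in h * => z0.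
  have h2 : z ^+ 2 <= (rnorm (c : Cspace R) * rnorm (a i) + rnorm (b i)) ^+ 2.
    by rewrite lerXn2r// nnegrE (le_trans z0).
  apply: (le_trans h2); rewrite /k -mulrA -exprMn.
  set p := _ * rnorm (a i); set q := rnorm (b i).
  rewrite -subr_ge0 (_ : _ - _ = (p - q) ^+ 2) ?sqr_ge0//.
  by rewrite sqrrB sqrrD; ring.
rewrite esumTD ?esumTZ ?lte_add_pinfty ?lte_mul_pinfty ?lee_fin//.
- by move=> i; rewrite sqr_ge0.
- by move=> i; rewrite sqr_ge0.
- by move=> i; rewrite mulr_ge0// sqr_ge0.
- by move=> i; rewrite mulr_ge0// sqr_ge0.
Qed.

HB.instance Definition _ :=
  GRing.isSubmodClosed.Build R[i] (I -> E) ell2_pred ell2_submod_closed.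

(* Square-summable families (a i)_i of elements of E. *)
Record ell2 := Ell2 { ell2_fun :> I -> E ; ell2P : ell2_fun \in ell2_pred }.

HB.instance Definition _ := [isSub for ell2_fun].
HB.instance Definition _ := [Choice of ell2 by <:].
HB.instance Definition _ := [SubChoice_isSubLmodule of ell2 by <:].
End Ell2.

Section Ell2Hilbert.
Variables (R : realType) (I : choiceType) (E : hilbertType R).
Local Notation ell2 := (ell2 I E).
Implicit Types a b : ell2.

Lemma rnorm_hdot (H : hilbertType R) (x y : H) :
  rnorm (hdot x y : Cspace R) <= rnorm x * rnorm y.
Proof.
have := dot_CauchySchwarz hdot x y; rewrite !hdotxx -exprMn.
rewrite ler_pXn2r// ?nnegrE ?mulr_ge0//.
by rewrite -lecR rmorphM/= !rnormE.
Qed.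

Lemma ell2_fin a : (\esum_(i in [set: I]) (rnorm (a i) ^+ 2)%:E < +oo)%E.
Proof. by have := ell2P a; rewrite unfold_in => /asboolP. Qed.

Definition ell2_dot a b : R[i] := csum (fun i => hdot (a i) (b i)).

Lemma ell2_dot_summable a b : csummable (fun i => hdot (a i) (b i)).
Proof.
rewrite /csummable; apply: (@le_lt_trans _ _
  (\esum_(i in [set: I]) (rnorm (a i) ^+ 2 + rnorm (b i) ^+ 2)%:E)%E).
  apply: esumT_le => i; apply: (le_trans (rnorm_hdot (a i) (b i))).
  set p := rnorm (a i); set q := rnorm (b i).
  have p0 : 0 <= p by exact: rnorm_ge0.
  have q0 : 0 <= q by exact: rnorm_ge0.
  nra.
rewrite esumTD ?lte_add_pinfty ?ell2_fin// => i; exact: sqr_ge0.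
Qed.

Lemma ell2_dot_bilinear :
  bilinear_for (GRing.mul : GRing.Scale.law R[i] R[i])
    (Num.conj \; GRing.mul : GRing.Scale.law R[i] R[i]) ell2_dot.
Proof.
split=> [b c a a'|a c b b'] /=.
  rewrite -(csumZ c (ell2_dot_summable a b)) -csumD.
  - congr csum; apply/funext => i.
    by rewrite /= linearDl/= linearZl_LR.
  - have := ell2_dot_summable (c *: a) b; congr csummable.
    by apply/funext => i; rewrite linearZl_LR.
  - exact: ell2_dot_summable.
rewrite -(csumZ _ (ell2_dot_summable a b)) -csumD.
- congr csum; apply/funext => i.
  by rewrite /= linearDr/= linearZr_LR.
- have := ell2_dot_summable a (c *: b); congr csummable.
  by apply/funext => i; rewrite linearZr_LR.
- exact: ell2_dot_summable.
Qed.

HB.instance Definition _ :=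
  @bilinear_isBilinear.Build R[i] ell2 ell2 R[i] *%R (Num.conj \; *%R) ell2_dot
    ell2_dot_bilinear.

Lemma ell2_dotC a b :
  ell2_dot a b = (-1) ^+ false * Num.conj (ell2_dot b a).
Proof.
rewrite mul1r -(csum_conj (ell2_dot_summable b a)); congr csum.
by apply/funext => i; rewrite hermC mul1r.
Qed.

HB.instance Definition _ := @isHermitianSesquilinear.Build R[i] ell2 false
  Num.conj ell2_dot ell2_dotC.

Definition ell2_norm a : R[i] :=
  (Num.sqrt (fine (\esum_(i in [set: I]) (rnorm (a i) ^+ 2)%:E)%E))%:C.

Lemma ell2_dotxx a : ell2_dot a a = ell2_norm a ^+ 2.
Proof.
rewrite /ell2_norm -rmorphXn/= sqr_sqrtr; last first.
  by rewrite fine_ge0// esumT_ge0// => i; exact: sqr_ge0.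
rewrite -rsum_ge0E ?ell2_fin//; last by move=> i; exact: sqr_ge0.
rewrite -csum_real; congr csum; apply/funext => i.
by rewrite hdotxx rmorphXn/= rnormE.
Qed.

Lemma ell2_norm_ge0 a : 0 <= ell2_norm a.
Proof. by rewrite ler0c sqrtr_ge0. Qed.

Lemma ell2_coord_le a i : rnorm (a i) <= complex.Re (ell2_norm a).
Proof.
rewrite /ell2_norm/= -(@ler_pXn2r _ 2)// ?nnegrE ?rnorm_ge0 ?sqrtr_ge0//.
have h0 j : 0 <= rnorm (a j) ^+ 2 by exact: sqr_ge0.
rewrite sqr_sqrtr ?fine_ge0 ?esumT_ge0// -lee_fin fineK ?esumT_fin ?ell2_fin//.
by apply: esum_ge; exists [set i]; [split => //; exact: finite_set1|rewrite fsbig_set1].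
Qed.

Lemma ell2_norm_eq0 a : ell2_norm a = 0 -> a = 0.
Proof.
move=> a0; apply/val_inj/funext => i; apply: rnorm0_eq0; apply/eqP.
by rewrite eq_le rnorm_ge0 andbT; have := ell2_coord_le a i; rewrite a0.
Qed.

Lemma ell2_dot_gt0 a : a != 0 -> 0 < ell2_dot a a.
Proof.
move=> a0; rewrite ell2_dotxx exprn_gt0// lt_def ell2_norm_ge0 andbT.
by apply: contra_neq a0 => /ell2_norm_eq0.
Qed.

HB.instance Definition _ := @isDotProduct.Build R[i] ell2 ell2_dot ell2_dot_gt0.

Lemma ell2_normE a : ell2_norm a = sqrtC (ell2_dot a a).
Proof. by rewrite ell2_dotxx sqrCK// ell2_norm_ge0. Qed.

Lemma ell2_normD a b : ell2_norm (a + b) <= ell2_norm a + ell2_norm b.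
Proof. by rewrite !ell2_normE; exact: dot_triangle. Qed.

Lemma ell2_normZ (c : R[i]) a : ell2_norm (c *: a) = `|c| * ell2_norm a.
Proof.
rewrite !ell2_normE dnormZ sqrtCM ?nnegrE ?exprn_ge0 ?dnorm_ge0//.
by rewrite sqrCK.
Qed.

HB.instance Definition _ :=
  Lmodule_isNormed.Build R[i] ell2 ell2_normD ell2_normZ ell2_norm_eq0.

Lemma ell2_rnorm a :
  (rnorm a ^+ 2)%:E = (\esum_(i in [set: I]) (rnorm (a i) ^+ 2)%:E)%E.
Proof.
have h0 j : 0 <= rnorm (a j) ^+ 2 by exact: sqr_ge0.
rewrite -[rnorm a]/(Num.sqrt _) sqr_sqrtr ?fine_ge0 ?esumT_ge0//.
by rewrite fineK// esumT_fin// ell2_fin.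
Qed.

Lemma ell2_rnorm_coord a i : rnorm (a i) <= rnorm a.
Proof. exact: ell2_coord_le. Qed.

Lemma rnorm_dist (V : normedModType R[i]) (u v w : V) :
  `|rnorm (u - w) - rnorm (v - w)| <= rnorm (u - v).
Proof.
rewrite ler_norml; apply/andP; split.
  rewrite lerNl opprB lerBlDr (rnorm_distC u v).
  by rewrite (_ : v - w = (v - u) + (u - w)) ?rnormD// addrA subrK.
rewrite lerBlDr (_ : u - w = (u - v) + (v - w)) ?rnormD// addrA subrK//.
Qed.

Lemma ell2_complete (F : set_system ell2) :
  ProperFilter F -> cauchy F -> cvg F.
Proof.
move=> FF /cauchyP Fc.
have rball (V : normedModType R[i]) (x y : V) (e : R) :
    ball x e%:C y -> rnorm (x - y) < e.
  by rewrite -ball_normE/= -rnormE ltcR.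
have cvgi i : cvg ((fun a : ell2 => a i) @ F).
  apply: cauchy_cvg; apply: cauchy_exP => e e0.
  have [x Fx] := Fc e e0; exists (x i).
  suff : F ((fun a : ell2 => a i) @^-1` ball (x i) e) by [].
  apply: filterS Fx => y; rewrite -!ball_normE/= => xy.
  by apply: le_lt_trans xy; rewrite -!rnormE lecR; exact: (ell2_rnorm_coord (x - y)).
pose l i := lim ((fun a : ell2 => a i) @ F).
have lP (x : ell2) (e : R) : F (ball x e%:C) ->
    (\esum_(i in [set: I]) (rnorm (l i - x i) ^+ 2)%:E <= (e ^+ 2)%:E)%E.
  move=> Fx; apply/esumT_fsetP; first by move=> i; exact: sqr_ge0.
  move=> X.
  have cvX : \sum_(i <- X) rnorm ((y : ell2) i - x i) ^+ 2 @[y --> F] -->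
      \sum_(i <- X) rnorm (l i - x i) ^+ 2.
    apply: cvg_big => [|i _]; first exact: add_continuous.
    have cn : rnorm ((y : ell2) i - x i) @[y --> F] --> rnorm (l i - x i).
      apply/cvgrPdist_lt => /= d d0.
      have Fd : F ((fun a : ell2 => a i) @^-1` ball (l i) d%:C).
        by have := cvgi i; apply; apply: nbhsx_ballx; rewrite ltcR.
      apply: filterS Fd => y /rball ly; apply: le_lt_trans ly.
      exact: rnorm_dist.
    exact: (cvgM cn cn).
  apply: (cvgr_to_le cvX); apply: filterS Fx => y /rball xy.
  have := ltW xy; rewrite rnorm_distC => yx.
  apply: (@le_trans _ _ (rnorm (y - x) ^+ 2)).
    have h0 j : 0 <= rnorm ((y - x) j) ^+ 2 by exact: sqr_ge0.
    have [_] := @esumT_fsetP _ _ (fun i => rnorm ((y - x) i) ^+ 2) (rnorm (y - x) ^+ 2) h0.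
    by apply; rewrite -ell2_rnorm.
  by rewrite lerXn2r// nnegrE ?rnorm_ge0// (le_trans _ yx)// rnorm_ge0.
have lE : l \in @ell2_pred R I E.
  have [x Fx] := Fc 1 ltr01.
  have lx : (fun i => l i - x i) \in @ell2_pred R I E.
    rewrite unfold_in; apply/asboolP.
    by apply: le_lt_trans (lP _ 1 Fx) _; rewrite ltry.
  have -> : l = (fun i => l i - x i) + (x : I -> E).
    by apply/funext => i /=; rewrite subrK.
  by rewrite rpredD// ell2P.
apply/cvg_ex; exists (Ell2 lE); apply/cvgrPdist_lt => /= e e0.
have {e0}[r r0 ->] : exists2 r : R, 0 < r & e = r%:C.
  by exists (complex.Re e); rewrite ?RRe_real ?gtr0_real// -ltcR RRe_real ?gtr0_real.
have [|x Fx] := Fc (r / 2)%:C; first by rewrite ltcR divr_gt0.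
have Lx : rnorm (Ell2 lE - x) <= r / 2.
  have r20 : 0 <= r / 2 by rewrite divr_ge0// ltW.
  have : rnorm (Ell2 lE - x) ^+ 2 <= (r / 2) ^+ 2.
    by rewrite -lee_fin ell2_rnorm; exact: lP.
  by rewrite ler_pXn2r// nnegrE rnorm_ge0.
apply: filterS Fx => y /rball xy; rewrite -rnormE ltcR.
rewrite -(subrK x (Ell2 lE)) -addrA (le_lt_trans (rnormD _ _))//.
by rewrite (splitr r) ler_ltD.
Qed.

HB.instance Definition _ := Uniform_isComplete.Build ell2 ell2_complete.

Lemma ell2_hdotxx a : ell2_dot a a = `|a| ^+ 2.
Proof. exact: ell2_dotxx. Qed.

HB.instance Definition _ :=
  CompleteNormedModule_isHilbert.Build R ell2 ell2_hdotxx.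
End Ell2Hilbert.

Section Ell2Single.
Variables (R : realType) (I : choiceType) (E : hilbertType R).

Lemma ell2_single_subproof (i : I) (x : E) :
  (fun j => if j == i then x else 0) \in @ell2_pred R I E.
Proof.
rewrite unfold_in; apply/asboolP.
rewrite (_ : (\esum_(j in _) _)%E = (rnorm x ^+ 2)%:E) ?ltry//.
rewrite -[RHS](@esum_set1 _ _ i (fun=> (rnorm x ^+ 2)%:E)) ?lee_fin ?sqr_ge0//.
rewrite [RHS]esum_mkcond; apply: eq_esum => j _.
case: eqVneq => [->|ji]; first by rewrite mem_set.
by rewrite memNset ?rnorm0 ?expr0n//=; exact/eqP.
Qed.

Definition ell2_single (i : I) (x : E) : ell2 I E :=
  Ell2 (ell2_single_subproof i x).
End Ell2Single.

Definition std_basis (R : realType) (J : choiceType) (j : J) :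
  ell2 J (Cspace R) := ell2_single j (1 : Cspace R).

(* An element g = \sum_n a_n z^n of the Hardy space H^2(T, E) is represented
   by its coefficient sequence (a_n), with norm^2 = \sum_n |a_n|^2. *)
Notation hardy2 E := (ell2 nat E).

Definition hardy_const (R : realType) (E : hilbertType R) (x : E) : hardy2 E :=
  ell2_single 0%N x.

Section Shift.
Variables (R : realType) (E : hilbertType R).

Lemma hardy_shift_subproof (a : hardy2 E) :
  (fun n => if n is m.+1 then a m else 0) \in @ell2_pred R nat E.
Proof.
rewrite unfold_in; apply/asboolP.
set b := fun n => _.
have b0 n : (0 <= b n)%E by rewrite lee_fin sqr_ge0.
rewrite (@esumID _ _ [set 0%N]) ?setTI; last by move=> n _; exact: b0.
rewrite esum_set1; last exact: (b0 0%N).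
rewrite rnorm0 expr0n/= add0e.
rewrite (_ : ~` [set 0%N] = succn @` [set: nat]).
  by rewrite esum_image ?ell2_fin//; apply: in2W succn_inj.
by apply/seteqP; split=> [[|n]//= _|_ [n _ <-]//]; exists n.
Qed.

(* Multiplication by z: z * \sum_n a_n z^n has coefficients 0, a_0, a_1, ...
   (see hardy_shift_sum for the partial sums). *)
Definition hardy_shift (a : hardy2 E) : hardy2 E :=
  Ell2 (hardy_shift_subproof a).

Lemma hardy_shift_sum (a : hardy2 E) (z : R[i]) (n : nat) :
  \sum_(k < n.+1) z ^+ k *: hardy_shift a k =
  z *: \sum_(k < n) z ^+ k *: a k.
Proof.
rewrite big_ord_recl/= scaler0 add0r scaler_sumr; apply: eq_bigr => k _.
by rewrite /= exprS scalerA.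
Qed.
End Shift.

Section Operators.
Variable R : realType.

Definition bounded_linear (U W : normedModType R[i]) (A : set U) (B : set W)
    (f : U -> W) : Prop :=
  [/\ set_fun A B f,
      forall (c : R[i]) (x y : U), A x -> A y ->
        f (c *: x + y) = c *: f x + f y
    & exists M : R, forall x, A x -> rnorm (f x) <= M * rnorm x].

(* f is an invertible operator from A onto B with inverse g; the values of f
   outside A and of g outside B are irrelevant. *)
Definition invertible_operator (U W : normedModType R[i]) (A : set U)
    (B : set W) (f : U -> W) (g : W -> U) : Prop :=
  [/\ bounded_linear A B f, bounded_linear B A g,
      {in A, cancel f g} & {in B, cancel g f}].

Definition closed_subspace (H : hilbertType R) (K : set H) : Prop :=
  [/\ K 0,
      forall (c : R[i]) (x y : H), K x -> K y -> K (c *: x + y)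
    & closed K].

Definition orthocomp (H : hilbertType R) (K : set H) : set H :=
  [set x | forall y, K y -> hdot x y = 0].

(* For a closed subspace K the set below is a singleton, by the projection
   theorem. *)
Definition orthproj (H : hilbertType R) (K : set H) (x : H) : H :=
  xget 0 [set y | K y /\ orthocomp K (x - y)].

Definition invariant_under (H : hilbertType R) (S : H -> H) (K : set H) :
  Prop := set_fun K K S.

Definition coinvariant_under (H : hilbertType R) (S : H -> H) (K : set H) :
  Prop := invariant_under S (orthocomp K).

Definition compression (H : hilbertType R) (K : set H) (S : H -> H) : H -> H :=
  fun x => orthproj K (S x).

Definition is_frame (H : hilbertType R) (I : countType) (x : I -> H) : Prop :=
  exists A B : R, [/\ 0 < A, 0 < B & forall h : H,
    ((A * rnorm h ^+ 2)%:E
       <= \esum_(i in [set: I]) (rnorm (hdot h (x i) : Cspace R) ^+ 2)%:E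
       <= (B * rnorm h ^+ 2)%:E)%E].
End Operators.

(* Main.v *)
Require Import Defs.
From HB Require Import structures.
From mathcomp Require Import all_boot all_order all_algebra.
From mathcomp Require Import complex ring lra.
From mathcomp Require Import all_classical all_reals all_analysis.
Set Implicit Arguments.
Unset Strict Implicit.
Unset Printing Implicit Defensive.
Import Order.TTheory GRing.Theory Num.Theory.
Import numFieldNormedType.Exports.
Local Open Scope classical_set_scope.
Local Open Scope ring_scope.
Local Open Scope complex_scope.

(* For a frame let U h have the coefficients <h, T^n f_j>, an operator bounded
   and bounded below from H into the Hardy space, and let V be its adjoint. Then
   V sends the monomial z^n e_j to T^n f_j, V S = T V, and ker V is the
   orthogonal complement of K := range U; since V U is coercive, V restricts to
   an isomorphism K -> H with inverse U (V U)^-1, and V P_K = V gives the model.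
   Conversely W := V P_K satisfies W S = T W by coinvariance, so W sends z^n e_j
   to T^n f_j and the frame sum at h is |W* h|^2, which is bounded below because
   W has the bounded right inverse Vinv. *)

(** * Norm topology and inner product identities *)

Section HilbertSpace.
Variables (R : realType) (H : hilbertType R).
Implicit Types (x y z : H) (K : set H).

Lemma rnorm_ball x y (e : R) : ball x e%:C y <-> rnorm (x - y) < e.
Proof. by rewrite -ball_normE/= -rnormE ltcR. Qed.

Lemma nbhs_rnormP x (A : set H) :
  nbhs x A <-> exists2 e : R, 0 < e & forall y, rnorm (x - y) < e -> A y.
Proof.
split=> [/nbhs_ballP[e /= e0 eA]|[e e0 eA]].
  exists (complex.Re e); first by rewrite -ltcR RRe_real ?gtr0_real.
  by move=> y /rnorm_ball; rewrite RRe_real ?gtr0_real//; exact: eA.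
apply/nbhs_ballP; exists e%:C; first by rewrite /= ltcR.
by move=> y /rnorm_ball; exact: eA.
Qed.

Lemma closed_rnormP K : closed K <->
  forall x, (forall e : R, 0 < e -> exists2 y, K y & rnorm (x - y) < e) -> K x.
Proof.
split=> [cK x xK|KP x xK].
  apply: cK => A /nbhs_rnormP[e e0 eA]; have [y Ky xy] := xK e e0.
  by exists y; split=> //; exact: eA.
apply: KP => e e0; have [|y [Ky xy]] := xK [set y | rnorm (x - y) < e].
  by apply/nbhs_rnormP; exists e.
by exists y.
Qed.

(** The sets [D e] generate a proper Cauchy filter, and completeness supplies its limit [l]. This
    serves twice: for the near-minimizers of the projection theorem and for the approximate
    preimages in the closed range argument. *)
Lemma shrinking_sets_limit (D : R -> set H) :
  (forall e, 0 < e -> D e !=set0) ->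
  (forall d e, d <= e -> D d `<=` D e) ->
  (forall d, 0 < d -> exists2 e, 0 < e &
    forall x y, D e x -> D e y -> rnorm (x - y) < d) ->
  exists l, forall d e, 0 < d -> 0 < e -> exists2 x, D e x & rnorm (l - x) < d.
Proof.
move=> D0 Dm Dd.
pose F := filter_from [set e : R | 0 < e] D.
have FF : ProperFilter F.
  apply: filter_from_proper => //; apply: filter_from_filter; first by exists 1 => /=.
  move=> d e /= d0 e0; exists (Num.min d e) => /=; first by rewrite lt_min d0.
  by move=> x Dx; split; apply: Dm Dx; rewrite ge_min lexx ?orbT.
have : cvg F.
  apply: cauchy_cvg; apply: cauchy_exP => e e0.
  have r0 : 0 < complex.Re e by rewrite -ltcR RRe_real ?gtr0_real.
  have [d d0 dP] := Dd _ r0; have [x Dx] := D0 _ d0.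
  exists x, d => //= y Dy; rewrite -(RRe_real (gtr0_real e0)).
  by apply/rnorm_ball; exact: dP.
move=> /cvg_ex[l Fl]; exists l => d e d0 e0.
have Fb : F [set y | rnorm (l - y) < d] by apply: Fl; apply/nbhs_rnormP; exists d.
have FD : F (D e) by exists e.
by have [x []] := filter_ex (filterI FD Fb); exists x.
Qed.

Lemma hdot_rnorm x : hdot x x = (rnorm x ^+ 2)%:C.
Proof. by rewrite hdotxx rmorphXn/= rnormE. Qed.

Lemma rnorm_hdotxx x : rnorm (hdot x x : Cspace R) = rnorm x ^+ 2.
Proof. by rewrite hdot_rnorm /rnorm ger0_norm// ler0c sqr_ge0. Qed.

Lemma hdotC x y : hdot y x = Num.conj (hdot x y).
Proof. by rewrite hermC expr0 mul1r. Qed.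

Lemma hdotDl x y z : hdot (x + y) z = hdot x z + hdot y z.
Proof. by rewrite linearDl. Qed.

Lemma hdotDr x y z : hdot z (x + y) = hdot z x + hdot z y.
Proof. by rewrite linearDr. Qed.

Lemma hdotNl x y : hdot (- x) y = - hdot x y.
Proof. by rewrite linearNl. Qed.

Lemma hdotNr x y : hdot x (- y) = - hdot x y.
Proof. by rewrite linearNr. Qed.

Lemma hdotZl (c : R[i]) x y : hdot (c *: x) y = c * hdot x y.
Proof. by rewrite linearZl_LR. Qed.

Lemma hdotZr (c : R[i]) x y : hdot x (c *: y) = Num.conj c * hdot x y.
Proof. by rewrite linearZr_LR. Qed.

Lemma hdot_eq x y : (forall z, hdot z x = hdot z y) -> x = y.
Proof.
move=> xy; apply/eqP; rewrite -subr_eq0 -(dnorm_eq0 hdot).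
by rewrite hdotDr hdotNr xy subrr.
Qed.

Lemma parallelogram x y :
  rnorm (x + y) ^+ 2 + rnorm (x - y) ^+ 2 = 2 * (rnorm x ^+ 2 + rnorm y ^+ 2).
Proof.
apply: (@complexI R). rewrite rmorphD [in RHS]rmorphM rmorph_nat rmorphD/= -!hdot_rnorm.
rewrite !(hdotDl, hdotDr, hdotNl, hdotNr); ring.
Qed.

(** At c = <x,y> / <y,y> the right-hand side becomes |<x,y>|^2 / <y,y>, the form needed in the
    projection theorem. *)
Lemma rnorm_subZ_sq x y (c : R[i]) :
  hdot x x - hdot (x - c *: y) (x - c *: y) =
  Num.conj c * hdot x y + c * Num.conj (hdot x y) - c * Num.conj c * hdot y y.
Proof.
rewrite -(hdotC x y) !(hdotDl, hdotDr, hdotNl, hdotNr, hdotZl, hdotZr); ring.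
Qed.

End HilbertSpace.

(** * Orthogonal projection onto a closed subspace *)

Section Projection.
Variables (R : realType) (H : hilbertType R) (K : set H).
Hypothesis cK : closed_subspace K.

Lemma closed_subspaceB x y : K x -> K y -> K (x - y).
Proof.
by case: cK => _ Kl _ Kx Ky; rewrite -scaleN1r addrC; exact: Kl.
Qed.

(** The point of K nearest to x is obtained as a limit of near-minimizers; its residual is
    orthogonal to K because no correction by a multiple of z in K shortens it. *)
Lemma orthproj_exists x : exists y, K y /\ orthocomp K (x - y).
Proof.
have [K0 Kl Kc] := cK.
pose E := [set rnorm (x - y) ^+ 2 | y in K].
have E0 : E !=set0 by exists (rnorm (x - 0) ^+ 2), 0.
have lbE : lbound E 0 by move=> _ [y _ <-]; exact: sqr_ge0.
have hE : has_inf E by split=> //; exists 0.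
pose d := inf E.
have dle y : K y -> d <= rnorm (x - y) ^+ 2.
  by move=> Ky; apply: ge_inf; [exists 0|exists y].
pose D (e : R) := [set y | K y /\ rnorm (x - y) ^+ 2 < d + e].
have [y yP] : exists l, forall d e : R, 0 < d -> 0 < e ->
    exists2 y, D e y & rnorm (l - y) < d.
  apply: shrinking_sets_limit.
  - move=> e e0; have [_ [y Ky <-] ye] := inf_adherent e0 hE.
    by exists y.
  - by move=> a b ab y [Ky ya]; split=> //; apply: lt_le_trans ya _; rewrite lerD2l.
  (* The midpoint of y and z lies in K, so the parallelogram law gives |y - z|^2 < 4 (d + e^2/4) - 4
     d = e^2. *)
  - move=> e e0; exists (e ^+ 2 / 4); first by rewrite divr_gt0// exprn_gt0.
    move=> y z [Ky yd] [Kz zd].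
    have := parallelogram (x - y) (x - z).
    rewrite (_ : x - y - (x - z) = z - y); last by rewrite opprB addrC addrA subrK.
    have -> : x - y + (x - z) = 2 *: (x - 2^-1 *: (y + z)).
      rewrite scalerBr scalerA divff// scale1r scaler_nat mulr2n.
      by rewrite addrACA opprD.
    rewrite rnormZ (_ : rnorm (2 : R[i]^o) = 2); last first.
      by rewrite /rnorm ger0_norm.
    have : d <= rnorm (x - 2^-1 *: (y + z)) ^+ 2.
      apply: dle; rewrite -[_ *: _]addr0; apply: (Kl _ _ _ _ K0).
      by rewrite -[y]scale1r; exact: Kl.
    rewrite exprMn (rnorm_distC z y) -(@ltr_pXn2r _ 2)// ?nnegrE ?rnorm_ge0 ?(ltW e0)//.
    set m := rnorm (x - 2^-1 *: _) ^+ 2; set b := rnorm (y - z) ^+ 2.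
    move: yd zd; set p := rnorm (x - y) ^+ 2; set q := rnorm (x - z) ^+ 2.
    set r := e ^+ 2; lra.
have Ky : K y.
  move/closed_rnormP : Kc; apply => e e0.
  by have [z [Kz _]] := yP _ _ e0 ltr01; exists z.
have ymin z : K z -> rnorm (x - y) ^+ 2 <= rnorm (x - z) ^+ 2.
  move=> Kz; apply: le_trans (dle _ Kz); rewrite leNgt; apply/negP => ds.
  set s := rnorm (x - y) in ds.
  have s0 : 0 <= s by exact: rnorm_ge0.
  (* If s^2 > d, a point u of [D e] within e of y, at distance p from x, has s <= p + e and p^2 < d
     + e. Then s^2 - p^2 <= 2 s e, hence s^2 < d + e (2 s + 1), which contradicts e (2 s + 2) = s^2
     - d. *)
  pose e := (s ^+ 2 - d) / (2 * s + 2).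
  have e0 : 0 < e by rewrite divr_gt0 ?subr_gt0//; lra.
  have eE : e * (2 * s + 2) = s ^+ 2 - d by rewrite divfK//; apply: lt0r_neq0; lra.
  have [u [_ ud] yu] := yP _ _ e0 e0.
  have : s <= rnorm (x - u) + e.
    rewrite /s (_ : x - y = (x - u) + (u - y)); last by rewrite addrA subrK.
    by rewrite (le_trans (rnormD _ _))// lerD2l rnorm_distC ltW.
  move: ud (rnorm_ge0 (x - u)); set p := rnorm (x - u) => pd p0 sp.
  have : s ^+ 2 - p ^+ 2 <= 2 * s * e; last by move: eE; lra.
  rewrite subr_sqr; have [ps|ps] := leP s p.
    have := mulr_ge0 s0 (ltW e0); have : 0 <= s + p by exact: addr_ge0.
    nra.
  by rewrite [leRHS]mulrC ler_pM ?subr_ge0 ?addr_ge0// ?(ltW ps)//; lra.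
exists y; split=> // z Kz.
have [->|z0] := eqVneq z 0; first by rewrite linear0r.
have zz : 0 < hdot z z by rewrite lt_def dnorm_eq0 z0 dnorm_ge0.
(* This c minimizes |w - c z|. Subtracting c z lowers the squared norm by |<w,z>|^2 / <z,z>, so
   minimality of |w| forces <w,z> = 0. *)
set w := x - y; pose c := hdot w z / hdot z z.
have : rnorm w ^+ 2 <= rnorm (w - c *: z) ^+ 2.
  by rewrite /w -addrA -opprD; apply: ymin; rewrite addrC; exact: Kl.
rewrite -lecR -!hdot_rnorm -subr_le0 rnorm_subZ_sq {}/c.
rewrite rmorphM fmorphV /= (geC0_conj (dnorm_ge0 hdot z)).
rewrite mulrAC [X in X + _ - _]mulrC mulrA.
set p := hdot w z; set q := hdot z z in zz *.
rewrite (_ : _ - _ = p * Num.conj p / q); last first.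
  by field; rewrite gt_eqF.
rewrite -normCK pmulr_lle0 ?invr_gt0// => p0.
apply/eqP; rewrite -normr_eq0 -sqrf_eq0; apply/eqP/le_anti.
by rewrite p0 exprn_ge0.
Qed.

Lemma orthprojP x : K (orthproj K x) /\ orthocomp K (x - orthproj K x).
Proof.
have [y yP] := orthproj_exists x.
exact: (xgetPex (P := [set y | K y /\ orthocomp K (x - y)]) 0 (ex_intro _ y yP)).
Qed.

Lemma orthproj_mem x : K (orthproj K x). Proof. by case: (orthprojP x). Qed.

Lemma orthproj_orth x : orthocomp K (x - orthproj K x).
Proof. by case: (orthprojP x). Qed.

(** Two candidates for the projection differ by a vector that lies in K and is orthogonal to K. *)
Lemma orthprojE x y : K y -> orthocomp K (x - y) -> orthproj K x = y.
Proof.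
move=> Ky xy; have [Kp xp] := orthprojP x.
have Kd : K (orthproj K x - y) by exact: closed_subspaceB.
apply/eqP; rewrite -subr_eq0 -(dnorm_eq0 hdot).
rewrite -[X in hdot X _](_ : (x - y) - (x - orthproj K x) = _); last first.
  by rewrite opprB addrC addrA subrK.
by rewrite hdotDl hdotNl xy// xp// subrr.
Qed.

Lemma orthproj_linear (c : R[i]) x y :
  orthproj K (c *: x + y) = c *: orthproj K x + orthproj K y.
Proof.
have [_ Kl _] := cK; apply: orthprojE.
  by apply: Kl; exact: orthproj_mem.
move=> z Kz; rewrite opprD addrACA -scalerBr hdotDl hdotZl.
by rewrite !orthproj_orth// mulr0 addr0.
Qed.

(** Pythagoras for the decomposition of x into its projection p and the residual w. *)
Lemma rnorm_orthproj x : rnorm (orthproj K x) <= rnorm x.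
Proof.
have [Kp xp] := orthprojP x; set p := orthproj K x in Kp xp *.
rewrite -(@ler_pXn2r _ 2)// ?nnegrE ?rnorm_ge0// -lecR -!hdot_rnorm.
set w := x - p in xp.
have -> : hdot x x = hdot (w + p) (w + p) by rewrite subrK.
have wp : hdot w p = 0 by exact: xp.
have pw : hdot p w = 0 by rewrite hdotC wp rmorph0.
rewrite hdotDl (hdotDr w p w) (hdotDr w p p) wp pw addr0 add0r lerDr; exact: dnorm_ge0.
Qed.

End Projection.

(** * Riesz representation, adjoints, closed ranges and coercive operators *)

Section BoundedOperators.
Variable R : realType.
Implicit Types (U V W : normedModType R[i]) (H : hilbertType R).

(** The bound is made positive so that later estimates may divide by it. *)
Lemma bounded_linear_bound U W (A : set U) (B : set W) f :
  bounded_linear A B f ->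
  exists2 M : R, 0 < M & forall x, A x -> rnorm (f x) <= M * rnorm x.
Proof.
move=> [_ _ [M fM]]; exists (Num.max M 1); first by rewrite lt_max ltr01 orbT.
move=> x Ax; apply: (le_trans (fM _ Ax)).
by rewrite ler_wpM2r ?rnorm_ge0// le_max lexx.
Qed.

Section Linear.
Variables (U W : normedModType R[i]) (f : U -> W).
Hypothesis fL : bounded_linear [set: U] [set: W] f.

Lemma bounded_linearP (c : R[i]) x y : f (c *: x + y) = c *: f x + f y.
Proof. by have [_ + _] := fL; exact. Qed.

Lemma bounded_linear0 : f 0 = 0.
Proof.
have := bounded_linearP 1 0 0; rewrite !scale1r addr0 => /eqP.
by rewrite -subr_eq subrr => /eqP.
Qed.

Lemma bounded_linearZ (c : R[i]) x : f (c *: x) = c *: f x.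
Proof. by rewrite -[c *: x]addr0 bounded_linearP bounded_linear0 addr0. Qed.

Lemma bounded_linearB x y : f (x - y) = f x - f y.
Proof. by rewrite addrC -scaleN1r bounded_linearP scaleN1r addrC. Qed.

End Linear.

Lemma bounded_linear_comp U V W (f : U -> V) (g : V -> W) :
  bounded_linear [set: U] [set: V] f -> bounded_linear [set: V] [set: W] g ->
  bounded_linear [set: U] [set: W] (g \o f).
Proof.
move=> fL gL; split=> // [c x y _ _ /=|]; first by rewrite !bounded_linearP.
have [M M0 fM] := bounded_linear_bound fL.
have [N N0 gN] := bounded_linear_bound gL.
exists (N * M) => x _ /=; apply: (le_trans (gN _ _)) => //.
by rewrite -mulrA ler_pM2l// fM.
Qed.

Lemma riesz_representation H (phi : H -> Cspace R) :
  bounded_linear [set: H] [set: Cspace R] phi ->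
  exists u, forall x, phi x = hdot x u.
Proof.
move=> phiL; pose N := [set x | phi x = 0].
have [M M0 phiM] := bounded_linear_bound phiL.
have cN : closed_subspace N.
  split=> [|c x y Nx Ny|]; first exact: bounded_linear0 phiL.
    by rewrite /N/= (bounded_linearP phiL) Nx Ny scaler0 addr0.
  apply/closed_rnormP => x xN; apply/rnorm0_eq0/eqP; rewrite eq_le rnorm_ge0 andbT.
  apply/ler_addgt0Pr => e e0; rewrite add0r.
  have [y Ny xy] := xN (e / M) (divr_gt0 e0 M0).
  rewrite -[phi x]subr0 -Ny -(bounded_linearB phiL) (le_trans (phiM _ _))//.
  by rewrite mulrC -ler_pdivlMr// ltW.
have [phi0|/existsNP[x0 phix0]] := pselect (forall x, phi x = 0).
  by exists 0 => x; rewrite linear0r phi0.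
have [p0N] := orthprojP cN x0; set p := orthproj N x0 in p0N *.
set w := x0 - p => wN.
have phiw : phi w = phi x0 by rewrite (bounded_linearB phiL) p0N subr0.
have w0 : hdot w w != 0.
  rewrite dnorm_eq0; apply/eqP => w0; apply: phix0.
  by rewrite -phiw w0 (bounded_linear0 phiL).
(* The vector phi(w) x - phi(x) w lies in the kernel N, hence is orthogonal to w, which gives phi(x)
   <w,w> = phi(w) <x,w>. The conjugate compensates for [hdot] being conjugate linear in its second
   argument. *)
exists (Num.conj (phi w : R[i]) / hdot w w *: w) => x.
rewrite hdotZr rmorphM fmorphV /= (geC0_conj (dnorm_ge0 hdot w)) conjCK.
have : hdot (phi w *: x - phi x *: w) w = 0.
  rewrite hdotC wN ?rmorph0// /N/= (bounded_linearB phiL) !(bounded_linearZ phiL).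
  by apply/eqP; rewrite subr_eq0; apply/eqP; exact: mulrC.
rewrite hdotDl hdotNl !hdotZl => /eqP; rewrite subr_eq0 => /eqP wx.
by rewrite mulrAC wx mulfK.
Qed.

(** For each y, Riesz representation of x |-> <f x, y> yields g y. *)
Lemma adjoint_exists (H1 H2 : hilbertType R) (f : H1 -> H2) :
  bounded_linear [set: H1] [set: H2] f ->
  exists2 g : H2 -> H1, bounded_linear [set: H2] [set: H1] g &
    forall x y, hdot (f x) y = hdot x (g y).
Proof.
move=> fL; have [M M0 fM] := bounded_linear_bound fL.
have /choice[g fg] : forall y, exists u, forall x, hdot (f x) y = hdot x u.
  move=> y; apply: riesz_representation; split=> // [c x x' _ _|].
    by rewrite (bounded_linearP fL) hdotDl hdotZl.
  exists (M * rnorm y) => x _; apply: (le_trans (rnorm_hdot _ _)).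
  by rewrite mulrAC ler_wpM2r ?rnorm_ge0// fM.
exists g => [|x y]; last exact: fg.
split=> // [c y z _ _|].
  by apply: hdot_eq => x; rewrite hdotDr hdotZr -!fg hdotDr hdotZr.
exists M => y _.
(* Boundedness comes from |g y|^2 = <f (g y), y> <= M |g y| |y|, divided by |g y| when it is
   nonzero. *)
have := rnorm_hdot (f (g y)) y; rewrite fg rnorm_hdotxx => gy.
have : rnorm (g y) ^+ 2 <= M * rnorm (g y) * rnorm y.
  by apply: (le_trans gy); rewrite ler_wpM2r ?rnorm_ge0// fM.
have := rnorm_ge0 (g y); rewrite le_eqVlt => /orP[/eqP<- _|gy0].
  by rewrite mulr_ge0 ?rnorm_ge0 ?ltW.
by rewrite expr2 mulrAC ler_pM2r.
Qed.

(** The lower bound makes approximate preimages of a limit point y Cauchy, and continuity of f sends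
    their limit to y. *)
Lemma bounded_below_closed_range (H1 H2 : hilbertType R) (f : H1 -> H2) (m : R) :
  bounded_linear [set: H1] [set: H2] f -> 0 < m ->
  (forall x, m * rnorm x <= rnorm (f x)) -> closed_subspace (range f).
Proof.
move=> fL m0 mf; have [M M0 fM] := bounded_linear_bound fL.
split=> [|c _ _ [x _ <-] [y _ <-]|].
- by exists 0; rewrite ?(bounded_linear0 fL).
- by exists (c *: x + y); rewrite ?(bounded_linearP fL).
apply/closed_rnormP => y yf.
pose D (e : R) := [set x | rnorm (y - f x) < e].
have [x xP] : exists l, forall d e : R, 0 < d -> 0 < e ->
    exists2 x, D e x & rnorm (l - x) < d.
  apply: shrinking_sets_limit => [e e0|d e de x|d d0].
  - by have [_ [x _ <-] xy] := yf _ e0; exists x.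
  - by move=> /= xd; exact: lt_le_trans de.
  (* Two points with images this close to y satisfy m |x - z| <= |f x - f z| < d m. *)
  exists (d * m / 2) => [|x z xy zy]; first by rewrite !divr_gt0 ?mulr_gt0.
  rewrite -(ltr_pM2l m0) (le_lt_trans (mf _))// (bounded_linearB fL).
  rewrite (_ : f x - f z = (y - f z) - (y - f x)); last first.
    by rewrite opprB [RHS]addrC addrA subrK.
  apply: le_lt_trans (rnormD _ _) _; rewrite rnormN.
  by move: xy zy; rewrite /D/=; lra.
exists x => //; apply/eqP; rewrite eq_sym -subr_eq0; apply/eqP/rnorm0_eq0/eqP.
rewrite eq_le rnorm_ge0 andbT; apply/ler_addgt0Pr => e e0; rewrite add0r.
have e2 : 0 < e / 2 by rewrite divr_gt0.
have [z yz xz] := xP _ _ (divr_gt0 e2 M0) e2.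
rewrite (_ : y - f x = (y - f z) - f (x - z)); last first.
  by rewrite (bounded_linearB fL) opprB addrA subrK.
apply: le_trans (rnormD _ _) _; rewrite rnormN (splitr e) lerD ?(ltW yz)//.
by rewrite (le_trans (fM _ _))// mulrC -ler_pdivlMr// ltW.
Qed.

(** The Lax-Milgram argument: by Cauchy-Schwarz g is bounded below, hence injective with closed
    range. A vector w orthogonal to the range has <g w, w> = 0, so coercivity gives w = 0 and g is
    onto. *)
Lemma coercive_bijective H (g : H -> H) (m : R) :
  bounded_linear [set: H] [set: H] g -> 0 < m ->
  (forall x, m * rnorm x ^+ 2 <= rnorm (hdot (g x) x : Cspace R)) ->
  exists2 g' : H -> H, bounded_linear [set: H] [set: H] g' &
    cancel g g' /\ cancel g' g.
Proof.
move=> gL m0 mg.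
have mg1 x : m * rnorm x <= rnorm (g x).
  have := rnorm_ge0 x; rewrite le_eqVlt => /orP[/eqP<-|x0].
    by rewrite mulr0 rnorm_ge0.
  rewrite -(ler_pM2r x0) -mulrA -expr2 (le_trans (mg x))//; exact: rnorm_hdot.
have cg := bounded_below_closed_range gL m0 mg1.
have /choice[g' gg'] : forall y, exists x, g x = y.
  move=> y; have [[x _ gx] yx] := orthprojP cg y; exists x.
  rewrite gx; apply/eqP; rewrite eq_sym -subr_eq0.
  set w := y - _ in yx *.
  have := mg w; rewrite hdotC yx ?rmorph0 ?rnorm0; last by exists w.
  rewrite pmulr_rle0// => w0; apply/eqP/rnorm0_eq0/eqP.
  by rewrite -sqrf_eq0 eq_le w0 sqr_ge0.
have gI x : g x = 0 -> x = 0.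
  move=> gx; apply/rnorm0_eq0/eqP; rewrite eq_le rnorm_ge0 andbT.
  by have := mg1 x; rewrite gx rnorm0 pmulr_rle0.
exists g'; last first.
  split=> // x; apply/eqP; rewrite -subr_eq0; apply/eqP/gI.
  by rewrite (bounded_linearB gL) gg' subrr.
split=> // [c x y _ _|].
  apply/eqP; rewrite -subr_eq0; apply/eqP/gI.
  by rewrite (bounded_linearB gL) (bounded_linearP gL) !gg' subrr.
by exists m^-1 => x _; rewrite ler_pdivlMl// (le_trans (mg1 _))// gg'.
Qed.

End BoundedOperators.

(** * Coordinates in the Hardy space *)

Section Coordinates.
Variable R : realType.

Lemma esum_single (I : choiceType) (i : I) (a : I -> \bar R) :
  (0 <= a i)%E -> (forall j, j != i -> a j = 0%E) ->
  (\esum_(j in [set: I]) a j)%E = a i.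
Proof.
move=> a0 ai; rewrite -[RHS](esum_set1 a0) [RHS]esum_mkcond.
apply: eq_esum => j _; have [->|ji] := eqVneq j i; first by rewrite mem_set.
by rewrite memNset ?ai//=; exact/eqP.
Qed.

Lemma rsum_single (I : choiceType) (i : I) (u : I -> R) :
  (forall j, j != i -> u j = 0) -> rsum u = u i.
Proof.
move=> ui; rewrite rsumE.
  rewrite !(@esum_single _ i) ?lee_fin ?posp_ge0 ?negp_ge0 //=.
  - by rewrite -posnegE.
  - by move=> j /ui uj; rewrite /negp uj oppr0 maxxx.
  - by move=> j /ui uj; rewrite /posp uj maxxx.
rewrite (@esum_single _ i) ?ltry ?lee_fin//.
by move=> j /ui ->; rewrite normr0.
Qed.

Lemma csum_single (I : choiceType) (i : I) (u : I -> R[i]) :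
  (forall j, j != i -> u j = 0) -> csum u = u i.
Proof.
move=> ui; rewrite /csum !(@rsum_single _ i); first by case: (u i).
- by move=> j /ui ->.
- by move=> j /ui ->.
Qed.

Lemma hdot_ell2_single (I : choiceType) (E : hilbertType R) (a : ell2 I E)
    (i : I) (x : E) : hdot a (ell2_single i x) = hdot (a i) x.
Proof.
rewrite [LHS](_ : _ = ell2_dot a (ell2_single i x))// /ell2_dot.
rewrite (csum_single (i := i)) /= ?eqxx// => j /negPf ->.
by rewrite linear0r.
Qed.

Lemma ell2_eqP (I : choiceType) (E : hilbertType R) (a b : ell2 I E) :
  (forall i, a i = b i) -> a = b.
Proof. by move=> ab; apply/val_inj/funext. Qed.

Lemma ell2_linE (I : choiceType) (E : hilbertType R) (c : R[i]) (a b : ell2 I E) i :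
  (c *: a + b) i = c *: a i + b i.
Proof. by []. Qed.

Lemma hardy_shift_isometry (E : hilbertType R) (a : hardy2 E) :
  rnorm (hardy_shift a) = rnorm a.
Proof.
apply/eqP; rewrite -(@eqrXn2 _ 2) ?rnorm_ge0//; apply/eqP/EFin_inj.
rewrite !ell2_rnorm.
rewrite (@esumID _ _ [set 0%N]) ?setTI; last by move=> n _; rewrite lee_fin sqr_ge0.
rewrite esum_set1; last by rewrite lee_fin sqr_ge0.
rewrite /= rnorm0 expr0n/= add0e.
rewrite (_ : ~` [set 0%N] = succn @` [set: nat]).
  by rewrite esum_image//; apply: in2W succn_inj.
by apply/seteqP; split=> [[|n]//= _|_ [n _ <-]//]; exists n.
Qed.

Lemma hardy_shift_bounded_linear (E : hilbertType R) :
  bounded_linear [set: hardy2 E] [set: hardy2 E] (@hardy_shift R E).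
Proof.
split=> // [c a b _ _|]; last first.
  by exists 1 => a _; rewrite hardy_shift_isometry mul1r.
by apply: ell2_eqP => -[|n]; rewrite ell2_linE //= scaler0 addr0.
Qed.

Variable J : countType.
Local Notation HJ := (hardy2 (ell2 J (Cspace R))).

(** The function z^n e_j. *)
Definition hardy_monomial (n : nat) (j : J) : HJ :=
  ell2_single n (std_basis R j).

Lemma hdot_hardy_monomial (a : HJ) n j : hdot a (hardy_monomial n j) = a n j.
Proof.
rewrite !hdot_ell2_single [LHS](_ : _ = cdot (a n j) 1)//.
by rewrite /cdot rmorph1 mulr1.
Qed.

Lemma hardy_shift_monomial n j :
  hardy_shift (hardy_monomial n j) = hardy_monomial n.+1 j.
Proof. by apply: ell2_eqP => -[|m]. Qed.

(** Summation by Tonelli turns the nested norm into one sum over [nat * J], the index set of the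
    frame. *)
Lemma hardy_rnorm (a : HJ) : (rnorm a ^+ 2)%:E =
  (\esum_(nj in [set: nat * J]) (rnorm (a nj.1 nj.2) ^+ 2)%:E)%E.
Proof.
rewrite ell2_rnorm; under eq_esum do rewrite ell2_rnorm.
rewrite (@esum_esum _ _ _ _ (fun=> [set: J])
  (fun n j => (rnorm (a n j) ^+ 2)%:E)); last first.
  by move=> n j _ _; rewrite lee_fin sqr_ge0.
by congr esum; apply/seteqP; split.
Qed.

(** Each row is square summable because its sum is a single term of the iterated sum. *)
Lemma hardy_of_coordinates (u : nat * J -> Cspace R) :
  (\esum_(nj in [set: nat * J]) (rnorm (u nj) ^+ 2)%:E < +oo)%E ->
  exists a : HJ, forall n j, a n j = u (n, j).
Proof.
move=> uf.
have uE : (\esum_(n in [set: nat]) \esum_(j in [set: J]) (rnorm (u (n, j)) ^+ 2)%:E)%E =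
    (\esum_(nj in [set: nat * J]) (rnorm (u nj) ^+ 2)%:E)%E.
  rewrite (@esum_esum _ _ _ _ (fun=> [set: J])
    (fun n j => (rnorm (u (n, j)) ^+ 2)%:E)).
    by congr esum; [apply/seteqP; split|apply/funext => -[]].
  by move=> n j _ _; rewrite lee_fin sqr_ge0.
have rowP n : (fun j => u (n, j)) \in @ell2_pred R J (Cspace R).
  rewrite unfold_in; apply/asboolP; apply: le_lt_trans uf; rewrite -uE.
  apply: esum_ge; exists [set n]; first by split=> //; exact: finite_set1.
  by rewrite fsbig_set1.
have aP : (fun n => Ell2 (rowP n)) \in @ell2_pred R nat (ell2 J (Cspace R)).
  rewrite unfold_in; apply/asboolP; under eq_esum do rewrite ell2_rnorm.
  by rewrite uE.
by exists (Ell2 aP).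
Qed.

End Coordinates.

(** * From frames to models and back *)

Section Frames.
Variables (R : realType) (H : hilbertType R) (J : countType).
Local Notation HJ := (hardy2 (ell2 J (Cspace R))).
Local Notation shift := (@hardy_shift R (ell2 J (Cspace R))).

(** The upper frame bound places the coefficients of h in the Hardy space; the frame sum is then |U
    h|^2, so U has norm bound sqrt B. *)
Lemma frame_analysis_operator (x : nat * J -> H) : is_frame x ->
  exists2 U : H -> HJ, bounded_linear [set: H] [set: HJ] U &
    (forall h n j, U h n j = hdot h (x (n, j))) /\
    exists2 A : R, 0 < A & forall h, A * rnorm h ^+ 2 <= rnorm (U h) ^+ 2.
Proof.
move=> [A [B [A0 B0 xAB]]].
have /choice[U UE] : forall h, exists a : HJ, forall n j, a n j = hdot h (x (n, j)).
  move=> h; apply: (hardy_of_coordinates (u := fun nj => hdot h (x nj))).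
  by case/andP: (xAB h) => _ /le_lt_trans; apply; rewrite ltry.
have UAB h : A * rnorm h ^+ 2 <= rnorm (U h) ^+ 2 <= B * rnorm h ^+ 2.
  have := xAB h; rewrite -!lee_fin hardy_rnorm.
  rewrite (eq_esum (b := fun nj => (rnorm (U h nj.1 nj.2) ^+ 2)%:E))//.
  by move=> -[n j] _ /=; rewrite UE.
exists U; last by split=> //; exists A => // h; case/andP: (UAB h).
split=> // [c h k _ _|].
  apply: ell2_eqP => n; apply: ell2_eqP => j.
  by rewrite !ell2_linE !UE hdotDl hdotZl.
exists (Num.sqrt B) => h _.
rewrite -(@ler_pXn2r _ 2)// ?nnegrE ?mulr_ge0 ?sqrtr_ge0 ?rnorm_ge0//.
by rewrite exprMn (sqr_sqrtr (ltW B0)); case/andP: (UAB h).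
Qed.

Lemma frame_model (T : H -> H) (f : J -> H) :
  bounded_linear [set: H] [set: H] T ->
  is_frame (fun nj : nat * J => iter nj.1 T (f nj.2)) ->
  exists (K : set HJ) (V : HJ -> H) (Vinv : H -> HJ),
    [/\ closed_subspace K,
        coinvariant_under shift K,
        invertible_operator K [set: H] V Vinv,
        forall x, K x -> Vinv (T (V x)) = compression K shift x
      & forall j : J, V (orthproj K (hardy_const (std_basis R j))) = f j].
Proof.
move=> hT /frame_analysis_operator[U UL [UE [A A0 UA]]].
have [V VL UV] := adjoint_exists UL.
have [T' _ TT'] := adjoint_exists hT.
have [S' _ SS'] := adjoint_exists (hardy_shift_bounded_linear (ell2 J (Cspace R))).
have UA' h : Num.sqrt A * rnorm h <= rnorm (U h).
  rewrite -(@ler_pXn2r _ 2)// ?nnegrE ?mulr_ge0 ?sqrtr_ge0 ?rnorm_ge0//.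
  by rewrite exprMn (sqr_sqrtr (ltW A0)); exact: UA.
have sA0 : 0 < Num.sqrt A by rewrite sqrtr_gt0.
have cK := bounded_below_closed_range UL sA0 UA'.
(* V U is the frame operator: <V U h, h> = |U h|^2, so the lower frame bound is its coercivity. *)
have VUU h : A * rnorm h ^+ 2 <= rnorm (hdot ((V \o U) h) h : Cspace R).
  rewrite hdotC -UV -hdotC rnorm_hdotxx; exact: UA.
have [G GL [GK KG]] := coercive_bijective (bounded_linear_comp UL VL) A0 VUU.
have kerV y : orthocomp (range U) y <-> V y = 0.
  split=> [yU|Vy _ [h _ <-]]; last by rewrite hdotC UV Vy linear0r rmorph0.
  apply: hdot_eq => z; rewrite -UV hdotC yU ?rmorph0 ?linear0r//.
have VP y : V (orthproj (range U) y) = V y.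
  have := orthproj_orth cK y; move/kerV; rewrite (bounded_linearB VL).
  by move/eqP; rewrite subr_eq0 eq_sym => /eqP.
(* Coordinate (n, j) of either side is <h, T^(n+1) f_j>: the backward shift of coefficients
   corresponds to the adjoint of T. Taking adjoints gives V S = T V. *)
have S'U h : S' (U h) = U (T' h).
  apply: ell2_eqP => n; apply: ell2_eqP => j.
  rewrite UE -hdot_hardy_monomial hdotC -SS' hardy_shift_monomial -hdotC.
  by rewrite hdot_hardy_monomial UE/= hdotC TT' -hdotC.
have VS y : V (shift y) = T (V y).
  apply: hdot_eq => z; rewrite -UV hdotC SS' S'U.
  by rewrite [RHS]hdotC TT' (hdotC (U _) y) UV -(hdotC (T' z)).
(* As [G] inverts V U, x = U h gives U G V x = U h = x. *)
have VK x : range U x -> U (G (V x)) = x by move=> [h _ <-]; congr U; exact: GK.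
exists (range U), V, (U \o G); split.
- exact: cK.
(* The complement of K is ker V, which V S = T V makes shift invariant. *)
- by move=> y /kerV Vy; apply/kerV; rewrite VS Vy (bounded_linear0 hT).
- split; [| |by move=> x /set_mem/VK|by move=> h _; exact: KG].
  + have [_ Vl [M VM]] := VL; split=> // [c x y _ _|]; first exact: Vl.
    by exists M => x _; exact: VM.
  + by have [_ Gl GM] := bounded_linear_comp GL UL; split.
(* T V x = V S x = V P_K S x, and U G V fixes P_K S x. *)
- move=> x Kx; rewrite /= -VS -VP; apply: VK; exact: orthproj_mem cK _.
(* The constant function e_j is the monomial with n = 0, so <z, V e_j> is coordinate (0, j) of U z,
   namely <z, f_j>. *)
- move=> j; rewrite VP; apply: hdot_eq => z.
  by rewrite -UV (hdot_hardy_monomial (U z) 0 j) UE.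
Qed.

(** The part of y orthogonal to K stays orthogonal to K under the shift, so it contributes nothing
    to the projection of S y. *)
Lemma coinvariant_compression (K : set HJ) (y : HJ) :
  closed_subspace K -> coinvariant_under shift K ->
  compression K shift (orthproj K y) = orthproj K (shift y).
Proof.
move=> cK SK; have SL := hardy_shift_bounded_linear (ell2 J (Cspace R)).
apply/esym/orthprojE => //; first exact: orthproj_mem.
set p := orthproj K y.
rewrite -[X in orthocomp K X](_ : shift (y - p) +
  (shift p - orthproj K (shift p)) = _); last first.
  by rewrite (bounded_linearB SL) addrA subrK.
move=> z Kz; rewrite hdotDl (orthproj_orth cK _ Kz) addr0.
by apply: SK Kz; exact: orthproj_orth.
Qed.

Lemma model_frame (T : H -> H) (f : J -> H) (K : set HJ) (V : HJ -> H)
    (Vinv : H -> HJ) :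
  closed_subspace K -> coinvariant_under shift K ->
  invertible_operator K [set: H] V Vinv ->
  (forall x, K x -> Vinv (T (V x)) = compression K shift x) ->
  (forall j : J, V (orthproj K (hardy_const (std_basis R j))) = f j) ->
  is_frame (fun nj : nat * J => iter nj.1 T (f nj.2)).
Proof.
move=> cK SK [VL VinvL _ VinvK] TV Vf.
(* Extending V by zero on the complement of K gives an operator on the whole Hardy space, to which
   the adjoint lemma applies. *)
pose W y := V (orthproj K y).
have WL : bounded_linear [set: HJ] [set: H] W.
  have [M M0 VM] := bounded_linear_bound VL; have [_ Vl _] := VL.
  split=> // [c x y _ _|].
    by rewrite /W orthproj_linear// Vl//; exact: orthproj_mem.
  exists M => y _; apply: (le_trans (VM _ (orthproj_mem cK y))).
  by rewrite ler_pM2l// rnorm_orthproj.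
(* Applying V to the intertwining relation at P_K y gives T W y = V S_K P_K y, and S_K P_K = P_K S
   by coinvariance. *)
have WS y : W (shift y) = T (W y).
  rewrite -[RHS]VinvK ?inE// TV; last exact: orthproj_mem.
  by rewrite coinvariant_compression.
have We n j : iter n T (f j) = W (hardy_monomial R n j).
  elim: n => [|n IHn]; first by rewrite /= -Vf.
  rewrite -hardy_shift_monomial WS -IHn; exact: iterS.
have WVinv h : W (Vinv h) = h.
  have KV : K (Vinv h) by have [KV _ _] := VinvL; exact: KV.
  rewrite /W (orthprojE cK KV) ?subrr; last by move=> z _; rewrite linear0l.
  by rewrite VinvK ?inE.
have [W' W'L WW'] := adjoint_exists WL.
have W'E h : (\esum_(nj in [set: nat * J])
    (rnorm (hdot h (iter nj.1 T (f nj.2)) : Cspace R) ^+ 2)%:E =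
    (rnorm (W' h) ^+ 2)%:E)%E.
  rewrite hardy_rnorm; apply: eq_esum => -[n j] _ /=.
  by rewrite We hdotC WW' -hdotC hdot_hardy_monomial.
have [M M0 W'M] := bounded_linear_bound W'L.
have [N N0 VN] := bounded_linear_bound VinvL.
(* Here N bounds [Vinv] and M bounds the adjoint of W. *)
exists (N ^- 2), (M ^+ 2); split; rewrite ?invr_gt0 ?exprn_gt0// => h.
(* Since W [Vinv] h = h, |h|^2 = <[Vinv] h, W' h> <= N |h| |W' h|. *)
have W'lo : N^-1 * rnorm h <= rnorm (W' h).
  rewrite ler_pdivrMl//; have := rnorm_ge0 h; rewrite le_eqVlt => /orP[/eqP<-|h0].
    by rewrite mulr_ge0 ?rnorm_ge0// ltW.
  have := rnorm_hdot (Vinv h) (W' h); rewrite -WW' WVinv rnorm_hdotxx => hh.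
  rewrite -(ler_pM2r h0) -expr2 (le_trans hh)// mulrAC.
  by rewrite ler_wpM2r ?rnorm_ge0// VN.
rewrite W'E !lee_fin -exprVn -!exprMn; apply/andP; split; apply: lerXn2r => //;
  rewrite ?nnegrE ?rnorm_ge0 ?mulr_ge0 ?rnorm_ge0 ?invr_ge0 ?(ltW M0) ?(ltW N0)//.
exact: W'M.
Qed.

End Frames.

Theorem theorem2p1 (R : realType) (H : hilbertType R) (T : H -> H)
    (hT : bounded_linear [set: H] [set: H] T) (J : countType) (f : J -> H) :
  is_frame (fun nj : nat * J => iter nj.1 T (f nj.2)) <->
  exists (K : set (hardy2 (ell2 J (Cspace R))))
         (V : hardy2 (ell2 J (Cspace R)) -> H)
         (Vinv : H -> hardy2 (ell2 J (Cspace R))),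
    [/\ closed_subspace K,
        coinvariant_under (@hardy_shift R (ell2 J (Cspace R))) K,
        invertible_operator K [set: H] V Vinv,
        forall x, K x ->
          Vinv (T (V x)) =
          compression K (@hardy_shift R (ell2 J (Cspace R))) x
      & forall j : J, V (orthproj K (hardy_const (std_basis R j))) = f j].
Proof.
split=> [|[K [V [Vinv [cK SK VK TV Vf]]]]]; first exact: frame_model.
exact: (model_frame cK SK VK TV Vf).
Qed.
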